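(* For every term $M$ (whose only possible free variable is $o$), every $\omega\in\mathbb{B}^{\mathbb{N}}$ and every closed formula $A$ of the language below, if $M,\omega\Vdash A$ then $\omega\in[\![A]\!]$.
   Context: PCF-style typed language with base types $\mathrm{nat},\mathrm{bool}$, constructors $\to,\times$, pairs with projections $\pi_1,\pi_2$; $\mathrm O=\mathrm{nat}\to\mathrm{bool}$; $o$ is a fixed variable of type $\mathrm O$; $\overline k$ is the numeral for $k\in\mathbb{N}$; for a term $M$ with free variable at most $o$ and $\omega\in\mathbb{B}^{\mathbb{N}}$ ($\mathbb{B}=\{0,1\}$), $M^\omega$ is the closed program where calls $o\,\overline n$ are answered by $\omega(n)$; $M\Downarrow N$ means $M$ converges to normal form $N$. Formulas: $A::=\mathsf{FLIP}(t)\mid t=s\mid A\vee A\mid A\wedge A\mid A\to A\mid\exists x.A\mid\forall x.A\mid\mathbf{C}^{t/s}A\mid\mathbf{D}^{t/s}A$ over arithmetic terms $t::=x\mid0\mid S(t)\mid t+s\mid t\times s$. With $\mu$ the coin-flipping probability measure on the $\sigma$-algebra of $\mathbb{B}^{\mathbb{N}}$ generated by cylinders, closed formulas denote measurable sets: $[\![\mathsf{FLIP}(t)]\!]=\{\omega\mid\omega([\![t]\!])=1\}$; $[\![t=s]\!]$ is $\mathbb{B}^{\mathbb{N}}$ if $[\![t]\!]=[\![s]\!]$, else $\emptyset$; $\vee,\wedge$ are union, intersection; $[\![A\to B]\!]=(\mathbb{B}^{\mathbb{N}}\setminus[\![A]\!])\cup[\![B]\!]$; $\exists,\forall$ are countable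 union/intersection over instances $A(k/x)$; $[\![\mathbf{C}^{t/s}B]\!]=\mathbb{B}^{\mathbb{N}}$ if $[\![s]\!]>0$ and $\mu([\![B]\!])\ge[\![t]\!]/[\![s]\!]$, else $\emptyset$; $[\![\mathbf{D}^{t/s}B]\!]=\mathbb{B}^{\mathbb{N}}$ if $[\![s]\!]=0$ or $\mu([\![B]\!])<[\![t]\!]/[\![s]\!]$, else $\emptyset$. Realizability $M,\omega\Vdash A$ by induction on $A$: (1) $\mathsf{FLIP}(t)$: iff $\omega([\![t]\!])=1$; (2) $t=s$: iff $[\![t]\!]=[\![s]\!]$; (3) $A_1\vee A_2$: iff $\pi_1(M^\omega)$ converges to the boolean normal form indexing some $i\in\{1,2\}$ and $\pi_2(M),\omega\Vdash A_i$; (4) $A_1\wedge A_2$: iff $\pi_1(M),\omega\Vdash A_1$ and $\pi_2(M),\omega\Vdash A_2$; (5) $A\to B$: iff $\omega\in[\![A\to B]\!]$ and for every term $P$, $P,\omega\Vdash A$ implies $MP,\omega\Vdash B$; (6) $\exists x.A$: iff $\pi_1(M^\omega)\Downarrow\overline k$ and $\pi_2(M),\omega\Vdash A(k/x)$; (7) $\forall x.A$: iff for all $k$, $M\overline k,\omega\Vdash A(k/x)$; (8) $\mathbf{C}^{t/s}A$: iff $[\![s]\!]>0$ and $\mu(\{\omega'\mid Mo,\omega'\Vdash A\})\ge[\![t]\!]/[\![s]\!]$; (9) $\mathbf{D}^{t/s}A$: iff $\omega\in[\![\mathbf{D}^{t/s}A]\!]$ and ($[\![s]\!]=0$ or $\mu(\{\omega'\mid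 Mo,\omega'\Vdash A\})<[\![t]\!]/[\![s]\!]$). (The sets $\{\omega'\mid N,\omega'\Vdash A\}$ are measurable, so these measures are defined.) *)

(* Defs.v *)
From HB Require Import structures.
From Stdlib Require Import Relation_Operators.
From mathcomp Require Import all_boot all_order all_algebra.
From mathcomp Require Import all_classical all_reals all_analysis.
Import Order.TTheory GRing.Theory Num.Theory.
Set Implicit Arguments.
Unset Strict Implicit.
Unset Printing Implicit Defensive.
Local Open Scope classical_set_scope.
Local Open Scope ring_scope.

Definition oracle := nat -> bool.

Definition cylinder (s : seq bool) : set oracle :=
  [set w | forall i, (i < size s)%N -> w i = nth false s i].

Definition cylinders : set (set oracle) := range cylinder.

Notation cantor := (g_sigma_algebraType cylinders).

Definition is_coin_flipping (R : realType) (P : probability cantor R) : Prop :=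
  forall s : seq bool, P (cylinder s) = ((2^-1) ^+ size s)%:E.

Section coin_existence.
Variable R : realType.
Local Notation leb := (@lebesgue_measure R).

(* The existence witness is the image of Lebesgue measure on [0, 1[ under the
   binary digits. *)
Let fl (n : nat) (x : R) : int := Num.floor (2 ^+ n * x).
Let digits (x : R) : cantor := fun n => odd `|fl n.+1 x|%N.

Let fl_setE n (k : int) :
  [set x | fl n x = k] =
  `[(k%:~R / 2 ^+ n)%R, ((k + 1)%:~R / 2 ^+ n)%R[%classic.
Proof.
have p0 : (0 : R) < 2 ^+ n by rewrite exprn_gt0.
apply/seteqP; split => x /=; rewrite in_itv /= ler_pdivrMr// ltr_pdivlMr//.
  by move=> <-; rewrite [x * _]mulrC Num.Theory.floor_le Num.Theory.floorD1_gt.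
by rewrite [x * _]mulrC => h; exact: Num.Theory.floor_def.
Qed.

Let measurable_fl n (Q : int -> Prop) : measurable [set x | Q (fl n x)].
Proof.
have -> : [set x | Q (fl n x)] = \bigcup_(k in [set k | Q k]) [set x | fl n x = k].
  apply/seteqP; split => x /=; first by move=> ?; exists (fl n x).
  by move=> [k Qk] /= ->.
rewrite bigcup_mkcond; apply: countable_bigcupT_measurable => // k.
by case: ifP => // _; rewrite fl_setE; exact: measurable_itv.
Qed.

Let measurable_digits : measurable_fun setT digits.
Proof.
apply: (@measurability _ _ _ _ setT digits cylinders) => //.
move=> _ [_ [s _ <-] <-]; rewrite setTI.
have -> : digits @^-1` cylinder s =
    \bigcap_(i < size s) [set x | odd `|fl i.+1 x|%N = nth false s i].
  by apply/seteqP; split => x h i hi; exact: h.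
by apply: bigcap_measurableType => i _;
   exact: (measurable_fl i.+1 (fun k => odd `|k|%N = nth false s i)).
Qed.

Let D : set R := `[0%R, 1%R[%classic.
Let mD : measurable D. Proof. exact: measurable_itv. Qed.

Let val (s : seq bool) : nat := foldl (fun k (b : bool) => (k.*2 + b)%N) 0%N s.

Let fl_double n (x : R) : 0 <= x ->
  fl n.+1 x = ((`|fl n x|%N).*2 + odd `|fl n.+1 x|)%N :> int.
Proof.
move=> x0.
have f0 m : 0 <= fl m x by rewrite Num.Theory.floor_ge0 mulr_ge0// exprn_ge0.
have h1 := Num.Theory.floor_itv (2 ^+ n * x).
have h2 := Num.Theory.floor_itv (2 ^+ n.+1 * x).
rewrite -/(fl n x) in h1; rewrite -/(fl n.+1 x) in h2.
move: (f0 n) (f0 n.+1) h1 h2.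
case: (fl n x) => // a _; case: (fl n.+1 x) => // b _.
rewrite exprS -mulrA !intrD -!pmulrn !absz_nat.
move: (2 ^+ n * x) => y /andP[a1 a2] /andP[b1 b2].
have hb : (a.*2 <= b)%N.
  rewrite -ltnS -(ltr_nat R) -natr1 -muln2 natrM; apply: le_lt_trans b2.
  by rewrite mulrC ler_pM2l.
have hb' : (b < a.*2.+2)%N.
  rewrite -doubleS -(ltr_nat R) -muln2 natrM -natr1; apply: (le_lt_trans b1).
  by rewrite mulrC ltr_pM2r.
have : b = (a.*2)%N \/ b = (a.*2.+1)%N.
  move: hb hb'; rewrite ltnS leq_eqVlt => /predU1P[->|h1 h2]; first by left.
  by right; apply/eqP; rewrite eqn_leq h2 h1.
by case=> -> /=; rewrite odd_double /= ?addn0 ?addn1.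
Qed.

Let digits_val (s : seq bool) x : D x ->
  cylinder s (digits x) <-> fl (size s) x = val s.
Proof.
rewrite /D /= in_itv /= => /andP[x0 x1].
elim/last_ind: s => [|s b IH].
  split=> // _; rewrite /fl /= expr0 mul1r.
  by apply: Num.Theory.floor_def; rewrite x0.
have vE : val (rcons s b) = ((val s).*2 + b)%N by rewrite /val foldl_rcons.
rewrite vE size_rcons; split=> [h|h].
  have hs : cylinder s (digits x).
    by move=> i hi; rewrite h ?size_rcons ?leqW// nth_rcons hi.
  have := h (size s); rewrite size_rcons => /(_ (ltnSn _)).
  rewrite nth_rcons ltnn eqxx /digits => hb.
  by rewrite fl_double// hb (IH.1 hs).
have E := fl_double (size s) x0.
have hb : odd `|fl (size s).+1 x| = b.
  by rewrite h absz_nat oddD odd_double; case: (b).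
have hs : fl (size s) x = val s.
  have f0 : 0 <= fl (size s) x by rewrite Num.Theory.floor_ge0 mulr_ge0// exprn_ge0.
  move: E; rewrite hb h => -[/addIn/double_inj ->].
  by rewrite gez0_abs.
move=> i; rewrite size_rcons ltnS leq_eqVlt nth_rcons => /predU1P[->|hi].
  by rewrite ltnn eqxx.
by rewrite hi; exact: (IH.2 hs).
Qed.

Let val_lt s : (val s < 2 ^ size s)%N.
Proof.
elim/last_ind: s => [//|s b IH].
rewrite size_rcons /val foldl_rcons -/(val s) expnS mul2n.
by apply: (@leq_trans (val s).+1.*2); [rewrite doubleS ltnS; case: (b); rewrite ?addn1 ?addn0// ltnW|rewrite leq_double].
Qed.

Let coin : set cantor -> \bar R := pushforward (mrestr leb mD) digits.

Let coin0 : coin set0 = 0%E.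
Proof. by rewrite /coin /pushforward preimage_set0 measure0. Qed.

Let coin_ge0 A : (0 <= coin A)%E.
Proof. exact: measure_ge0. Qed.

Let coin_sigma_additive : semi_sigma_additive coin.
Proof.
move=> F mF tF mUF; rewrite /coin /pushforward preimage_bigcup.
apply: measure_semi_sigma_additive.
- by move=> n; rewrite -[X in measurable X]setTI; exact: measurable_digits.
- apply/trivIsetP => /= i j _ _ ij; rewrite -preimage_setI.
  by move/trivIsetP : tF => /(_ _ _ _ _ ij) ->//; rewrite preimage_set0.
- rewrite -preimage_bigcup -[X in measurable X]setTI.
  exact: measurable_digits.
Qed.

HB.instance Definition _ := isMeasure.Build _ _ _ coin
  coin0 coin_ge0 coin_sigma_additive.

Let coin_cylinder s : coin (cylinder s) = ((2^-1) ^+ size s)%:E.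
Proof.
have p0 : (0 : R) < 2 ^+ size s by rewrite exprn_gt0.
rewrite /coin /pushforward /mrestr.
have -> : digits @^-1` cylinder s `&` D =
    `[((val s)%:R / 2 ^+ size s)%R, ((val s).+1%:R / 2 ^+ size s)%R[%classic.
  have -> : ((val s).+1%:R : R) = (Posz (val s) + 1)%:~R.
    by rewrite -PoszD addn1 -pmulrn.
  have -> : ((val s)%:R : R) = (Posz (val s))%:~R by rewrite -pmulrn.
  rewrite -fl_setE.
  apply/seteqP; split => x /=; first by case=> /[swap] /digits_val /[apply].
  move=> h; suff Dx : D x by split=> //; apply/digits_val.
  have : [set x | fl (size s) x = val s] x by [].
  rewrite fl_setE /D /= !in_itv /= => /andP[h1 h2]; apply/andP; split.
    by apply: le_trans h1; rewrite divr_ge0// ltW.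
  apply: (lt_le_trans h2); rewrite ler_pdivrMr// mul1r -natrX.
  by rewrite -PoszD addn1 -pmulrn ler_nat val_lt.
rewrite lebesgue_measure_itv /= lte_fin ltr_pM2r ?invr_gt0// ltr_nat ltnSn.
by rewrite -EFinB -mulrBl -natrB// subSnn mul1r exprVn.
Qed.

Let coin_setT : coin setT = 1%:E.
Proof.
have := coin_cylinder [::]; rewrite expr0 => <-; congr coin.
by apply/seteqP; split.
Qed.

HB.instance Definition _ := Measure_isProbability.Build _ _ _ coin coin_setT.

Lemma coin_flipping_exists : exists P : probability cantor R, is_coin_flipping P.
Proof. by exists coin; exact: coin_cylinder. Qed.

End coin_existence.

Lemma coin_flipping_unique (R : realType) (P Q : probability cantor R) :
  is_coin_flipping P -> is_coin_flipping Q ->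
  forall A : set cantor, measurable A -> P A = Q A.
Proof.
move=> hP hQ A mA; pose G : set (set cantor) := cylinders `|` [set set0].
have Gm : G `<=` measurable.
  by move=> X [cX|->]; [exact: sub_sigma_algebra|exact: measurable0].
have T0 : cylinder [::] = setT by apply/seteqP; split.
have cylI (s t : seq bool) : (size s <= size t)%N ->
    G (cylinder s `&` cylinder t).
  move=> st; have [E|E] := eqVneq (take (size s) t) s.
    left; exists t => //; apply/seteqP; split=> w; last by case.
    move=> wt; split=> // i si.
    by rewrite wt ?(leq_trans si)// -[in RHS]E nth_take.
  right; apply/seteqP; split=> // w [ws wt]; move/eqP: E; apply.
  have sz : size (take (size s) t) = size s by rewrite size_takel.
  apply: (@eq_from_nth _ false) => // i; rewrite sz => si.
  by rewrite nth_take// -ws// wt// (leq_trans si).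
apply: (@g_sigma_algebra_measure_unique _ _ _ G Gm (fun=> setT)) => //.
- by move=> _; left; exists [::].
- by rewrite bigcup_const.
- move=> _ _ [[s _ <-]|->] [[t _ <-]|->]; rewrite ?set0I ?setI0; try by right.
  by case: (leqP (size s) (size t)) => [|/ltnW] st; last rewrite setIC; exact: cylI.
- move=> _ [[s _ <-]|->]; last by rewrite !measure0.
  exact: etrans (hP s) (esym (hQ s)).
- by move=> _; rewrite /= probability_setT ltry.
- by apply: (sub_sigma_algebra2 _ mA) => B cB; left.
Qed.

Definition coin_measure (R : realType) : probability cantor R :=
  sval (cid (coin_flipping_exists R)).

Lemma coin_measureP (R : realType) : is_coin_flipping (coin_measure R).
Proof. exact: svalP. Qed.

(* First-order variables are named by natural numbers. *)

Inductive aterm : Type :=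
| AVar (x : nat)
| AZero
| ASucc (t : aterm)
| AAdd (t s : aterm)
| AMul (t s : aterm).

Inductive form : Type :=
| FLIP (t : aterm)
| FEq (t s : aterm)
| FOr (A B : form)
| FAnd (A B : form)
| FImp (A B : form)
| FEx (x : nat) (A : form)
| FAll (x : nat) (A : form)
| FC (t s : aterm) (A : form)
| FD (t s : aterm) (A : form).

Fixpoint afv (t : aterm) : seq nat :=
  match t with
  | AVar x => [:: x]
  | AZero => [::]
  | ASucc t => afv t
  | AAdd t s | AMul t s => afv t ++ afv s
  end.

Fixpoint fv (A : form) : seq nat :=
  match A with
  | FLIP t => afv t
  | FEq t s => afv t ++ afv s
  | FOr A B | FAnd A B | FImp A B => fv A ++ fv B
  | FEx x A | FAll x A => [seq y <- fv A | y != x]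
  | FC t s A | FD t s A => afv t ++ afv s ++ fv A
  end.

Definition closed_form (A : form) : Prop := fv A = [::].

Definition env := nat -> nat.

Definition upd (e : env) (x k : nat) : env :=
  fun y => if y == x then k else e y.

Fixpoint aval (e : env) (t : aterm) : nat :=
  match t with
  | AVar x => e x
  | AZero => 0
  | ASucc t => (aval e t).+1
  | AAdd t s => aval e t + aval e s
  | AMul t s => aval e t * aval e s
  end%N.

(* The instances A(k/x) are handled by environments: [denote e A] is the
   meaning of the closed formula obtained from [A] by replacing each free
   variable [x] with the numeral of [e x]; see [denoteEx] and [denoteAll] for the
   clauses in terms of substitution. *)
Fixpoint denote (R : realType) (e : env) (A : form) : set oracle :=
  match A with
  | FLIP t => [set w | w (aval e t) = true]
  | FEq t s => [set _ | aval e t = aval e s]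
  | FOr A B => denote R e A `|` denote R e B
  | FAnd A B => denote R e A `&` denote R e B
  | FImp A B => ~` denote R e A `|` denote R e B
  | FEx x A => \bigcup_k denote R (upd e x k) A
  | FAll x A => \bigcap_k denote R (upd e x k) A
  | FC t s A => [set _ | (0 < aval e s)%N /\
      (((aval e t)%:R / (aval e s)%:R)%:E <= coin_measure R (denote R e A))%E]
  | FD t s A => [set _ | aval e s = 0%N \/
      (coin_measure R (denote R e A) < ((aval e t)%:R / (aval e s)%:R)%:E)%E]
  end.

Inductive ty : Type :=
| Nat
| Bool
| Arr (T1 T2 : ty)
| Prod (T1 T2 : ty).

(* Bound variables are de Bruijn indices; the fixed oracle variable [o] is the
   name [Orc], which no binder captures.  Hence "free variables among [o]" means
   typable in the empty context. *)
Inductive tm : Type :=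
| Var (n : nat)
| Orc
| Lam (T : ty) (M : tm)
| App (M N : tm)
| Fix (M : tm)
| Zero
| Succ (M : tm)
| Pred (M : tm)
| IsZero (M : tm)
| Tru
| Fls
| If (L M N : tm)
| Pair (M N : tm)
| Fst (M : tm)
| Snd (M : tm).

Inductive has_type : seq ty -> tm -> ty -> Prop :=
| T_Var G n T : onth G n = Some T -> has_type G (Var n) T
| T_Orc G : has_type G Orc (Arr Nat Bool)
| T_Lam G T1 T2 M : has_type (T1 :: G) M T2 -> has_type G (Lam T1 M) (Arr T1 T2)
| T_App G T1 T2 M N :
    has_type G M (Arr T1 T2) -> has_type G N T1 -> has_type G (App M N) T2
| T_Fix G T M : has_type G M (Arr T T) -> has_type G (Fix M) T
| T_Zero G : has_type G Zero Nat
| T_Succ G M : has_type G M Nat -> has_type G (Succ M) Nat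
| T_Pred G M : has_type G M Nat -> has_type G (Pred M) Nat
| T_IsZero G M : has_type G M Nat -> has_type G (IsZero M) Bool
| T_Tru G : has_type G Tru Bool
| T_Fls G : has_type G Fls Bool
| T_If G T L M N :
    has_type G L Bool -> has_type G M T -> has_type G N T ->
    has_type G (If L M N) T
| T_Pair G T1 T2 M N :
    has_type G M T1 -> has_type G N T2 -> has_type G (Pair M N) (Prod T1 T2)
| T_Fst G T1 T2 M : has_type G M (Prod T1 T2) -> has_type G (Fst M) T1
| T_Snd G T1 T2 M : has_type G M (Prod T1 T2) -> has_type G (Snd M) T2.

Definition is_term (M : tm) (T : ty) : Prop := has_type [::] M T.

Fixpoint num (k : nat) : tm := if k is k'.+1 then Succ (num k') else Zero.

Definition up_ren (r : nat -> nat) (n : nat) : nat :=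
  if n is n'.+1 then (r n').+1 else 0%N.

Fixpoint rename (r : nat -> nat) (M : tm) : tm :=
  match M with
  | Var n => Var (r n)
  | Orc => Orc
  | Lam T M => Lam T (rename (up_ren r) M)
  | App M N => App (rename r M) (rename r N)
  | Fix M => Fix (rename r M)
  | Zero => Zero
  | Succ M => Succ (rename r M)
  | Pred M => Pred (rename r M)
  | IsZero M => IsZero (rename r M)
  | Tru => Tru
  | Fls => Fls
  | If L M N => If (rename r L) (rename r M) (rename r N)
  | Pair M N => Pair (rename r M) (rename r N)
  | Fst M => Fst (rename r M)
  | Snd M => Snd (rename r M)
  end.

Definition up (f : nat -> tm) (n : nat) : tm :=
  if n is n'.+1 then rename S (f n') else Var 0.

Fixpoint subst (f : nat -> tm) (M : tm) : tm :=
  match M with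
  | Var n => f n
  | Orc => Orc
  | Lam T M => Lam T (subst (up f) M)
  | App M N => App (subst f M) (subst f N)
  | Fix M => Fix (subst f M)
  | Zero => Zero
  | Succ M => Succ (subst f M)
  | Pred M => Pred (subst f M)
  | IsZero M => IsZero (subst f M)
  | Tru => Tru
  | Fls => Fls
  | If L M N => If (subst f L) (subst f M) (subst f N)
  | Pair M N => Pair (subst f M) (subst f N)
  | Fst M => Fst (subst f M)
  | Snd M => Snd (subst f M)
  end.

Definition subst0 (N M : tm) : tm :=
  subst (fun n => if n is n'.+1 then Var n' else N) M.

(* Call-by-name reduction of the program M^w: [step w M M'] is one step of [M]
   with [Orc] read as the oracle [w], which answers the calls [Orc (num n)]. *)
Inductive step (w : oracle) : tm -> tm -> Prop :=
| S_Beta T M N : step w (App (Lam T M) N) (subst0 N M)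
| S_App M M' N : step w M M' -> step w (App M N) (App M' N)
| S_Call n : step w (App Orc (num n)) (if w n then Tru else Fls)
| S_CallArg N N' : step w N N' -> step w (App Orc N) (App Orc N')
| S_Fix M : step w (Fix M) (App M (Fix M))
| S_Succ M M' : step w M M' -> step w (Succ M) (Succ M')
| S_PredZero : step w (Pred Zero) Zero
| S_PredSucc n : step w (Pred (num n.+1)) (num n)
| S_Pred M M' : step w M M' -> step w (Pred M) (Pred M')
| S_IsZeroZero : step w (IsZero Zero) Tru
| S_IsZeroSucc n : step w (IsZero (num n.+1)) Fls
| S_IsZero M M' : step w M M' -> step w (IsZero M) (IsZero M')
| S_IfTru M N : step w (If Tru M N) M
| S_IfFls M N : step w (If Fls M N) N
| S_If L L' M N : step w L L' -> step w (If L M N) (If L' M N)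
| S_FstPair M N : step w (Fst (Pair M N)) M
| S_Fst M M' : step w M M' -> step w (Fst M) (Fst M')
| S_SndPair M N : step w (Snd (Pair M N)) N
| S_Snd M M' : step w M M' -> step w (Snd M) (Snd M').

Definition normal (w : oracle) (N : tm) : Prop := forall N', ~ step w N N'.

(* [converges w M N] is M^w ⇓ N. *)
Definition converges (w : oracle) (M N : tm) : Prop :=
  clos_refl_trans_1n tm (step w) M N /\ normal w N.

(* [realizes R e A T M w] is M, w ⊩ A for a term [M] of type [T] (types of terms
   are unique), with [e] as in [denote].  When [T] is not a type for which the
   terms built from [M] in a clause are typable, [M] does not realize [A].  In
   a disjunction, false and true (that is, 0 and 1) index the first and the
   second disjunct. *)
Fixpoint realizes (R : realType) (e : env) (A : form) (T : ty) (M : tm)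
    (w : oracle) : Prop :=
  match A with
  | FLIP t => w (aval e t) = true
  | FEq t s => aval e t = aval e s
  | FOr A1 A2 =>
      if T is Prod Bool T2 then
        (converges w (Fst M) Fls /\ realizes R e A1 T2 (Snd M) w) \/
        (converges w (Fst M) Tru /\ realizes R e A2 T2 (Snd M) w)
      else False
  | FAnd A1 A2 =>
      if T is Prod T1 T2 then
        realizes R e A1 T1 (Fst M) w /\ realizes R e A2 T2 (Snd M) w
      else False
  | FImp A B =>
      if T is Arr T1 T2 then
        denote R e (FImp A B) w /\
        forall P : tm, is_term P T1 ->
          realizes R e A T1 P w -> realizes R e B T2 (App M P) w
      else False
  | FEx x A =>
      if T is Prod Nat T2 then
        exists k, converges w (Fst M) (num k) /\
                  realizes R (upd e x k) A T2 (Snd M) w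
      else False
  | FAll x A =>
      if T is Arr Nat T2 then
        forall k, realizes R (upd e x k) A T2 (App M (num k)) w
      else False
  | FC t s A =>
      if T is Arr (Arr Nat Bool) T2 then
        (0 < aval e s)%N /\
        (((aval e t)%:R / (aval e s)%:R)%:E <=
           coin_measure R [set w' | realizes R e A T2 (App M Orc) w'])%E
      else False
  | FD t s A =>
      if T is Arr (Arr Nat Bool) T2 then
        denote R e (FD t s A) w /\
        (aval e s = 0%N \/
         (coin_measure R [set w' | realizes R e A T2 (App M Orc) w'] <
            ((aval e t)%:R / (aval e s)%:R)%:E)%E)
      else False
  end.

(* To be used on closed formulas, for which the environment is irrelevant. *)
Definition interp (R : realType) (A : form) : set oracle :=
  denote R (fun=> 0%N) A.

Definition realized (R : realType) (T : ty) (M : tm) (w : oracle) (A : form) :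
    Prop :=
  realizes R (fun=> 0%N) A T M w.

Definition anum (k : nat) : aterm := iter k ASucc AZero.

Fixpoint asubst (x k : nat) (t : aterm) : aterm :=
  match t with
  | AVar y => if y == x then anum k else AVar y
  | AZero => AZero
  | ASucc t => ASucc (asubst x k t)
  | AAdd t s => AAdd (asubst x k t) (asubst x k s)
  | AMul t s => AMul (asubst x k t) (asubst x k s)
  end.

(* [fsubst x k A] is A(k/x). *)
Fixpoint fsubst (x k : nat) (A : form) : form :=
  match A with
  | FLIP t => FLIP (asubst x k t)
  | FEq t s => FEq (asubst x k t) (asubst x k s)
  | FOr A B => FOr (fsubst x k A) (fsubst x k B)
  | FAnd A B => FAnd (fsubst x k A) (fsubst x k B)
  | FImp A B => FImp (fsubst x k A) (fsubst x k B)
  | FEx y A => FEx y (if y == x then A else fsubst x k A)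
  | FAll y A => FAll y (if y == x then A else fsubst x k A)
  | FC t s A => FC (asubst x k t) (asubst x k s) (fsubst x k A)
  | FD t s A => FD (asubst x k t) (asubst x k s) (fsubst x k A)
  end.

Section subst_lemmas.
Variable R : realType.

Let updd e x j k : upd (upd e x j) x k = upd e x k.
Proof. by apply/funext => z; rewrite /upd; case: (z == x). Qed.

Let updC e x y j k : (y == x) = false ->
  upd (upd e x j) y k = upd (upd e y k) x j.
Proof.
move=> yx; apply/funext => z; rewrite /upd.
by case: eqP => // ->; rewrite yx.
Qed.

Lemma aval_anum e k : aval e (anum k) = k.
Proof. by elim: k => //= k ->. Qed.

Lemma aval_subst e x k t : aval e (asubst x k t) = aval (upd e x k) t.
Proof.
elim: t => //= [y|t ->//|t -> s ->//|t -> s ->//].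
by rewrite /upd; case: ifP => //; rewrite aval_anum.
Qed.

Lemma denote_subst e x k A : denote R e (fsubst x k A) = denote R (upd e x k) A.
Proof.
elim: A e => /= [t|t s|A IA B IB|A IA B IB|A IA B IB|y A IA|y A IA|t s A IA|t s A IA] e;
  rewrite ?aval_subst ?IA ?IB//.
- by apply: eq_bigcup => // j _; case: ifPn => [/eqP->|/negbTE yx];
    rewrite ?updd// IA (updC e _ _ yx).
- by apply: eq_bigcap => // j _; case: ifPn => [/eqP->|/negbTE yx];
    rewrite ?updd// IA (updC e _ _ yx).
Qed.

Lemma realizes_subst e x k A :
  realizes R e (fsubst x k A) = realizes R (upd e x k) A.
Proof.
elim: A e => [t|t s|A IA B IB|A IA B IB|A IA B IB|y A IA|y A IA|t s A IA|t s A IA] e;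
  apply/funext => T; apply/funext => M; apply/funext => w /=;
  rewrite ?aval_subst ?denote_subst ?IA ?IB//.
- case: T => // -[]// T2; apply: eq_exists => j; congr (_ /\ _).
  by case: ifPn => [/eqP->|/negbTE yx]; rewrite ?updd// IA (updC e _ _ yx).
- case: T => // -[]// T2; apply: eq_forall => j.
  by case: ifPn => [/eqP->|/negbTE yx]; rewrite ?updd// IA (updC e _ _ yx).
Qed.

Lemma denoteEx x A : interp R (FEx x A) = \bigcup_k interp R (fsubst x k A).
Proof. by apply: eq_bigcup => // k _; rewrite /interp denote_subst. Qed.

Lemma denoteAll x A : interp R (FAll x A) = \bigcap_k interp R (fsubst x k A).
Proof. by apply: eq_bigcap => // k _; rewrite /interp denote_subst. Qed.

Lemma realizesEx T M w x A :
  realized R (Prod Nat T) M w (FEx x A) <->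
  exists k, converges w (Fst M) (num k) /\
            realized R T (Snd M) w (fsubst x k A).
Proof.
by rewrite /realized /=; split=> -[k h]; exists k; move: h;
  rewrite realizes_subst.
Qed.

Lemma realizesAll T M w x A :
  realized R (Arr Nat T) M w (FAll x A) <->
  forall k, realized R T (App M (num k)) w (fsubst x k A).
Proof.
by rewrite /realized /=; split=> h k; have := h k; rewrite realizes_subst.
Qed.

End subst_lemmas.

(* Main.v *)
From Stdlib Require Import Relation_Operators.
From mathcomp Require Import all_boot all_order all_algebra.
From mathcomp Require Import all_classical all_reals all_analysis.
Require Import Defs.
From mathcomp Require Import reals.

Local Open Scope classical_set_scope.

(** Soundness is an induction on the formula.  The implication and [D] clauses
    of realizability contain the denotation, and the only other clause that is
    not immediate is [C]: there one compares the measure of the set of oracles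
    realizing the body with that of its denotation, so both must be measurable.
    For the former, a computation consults the oracle at finitely many places,
    hence reduction is an open condition on the oracle, and all remaining
    quantifications (over terms, numerals) are countable. *)

(** Finitely branching trees with labels in [nat] form a countable type, so an injective code into
    them shows that the syntax is countable; node labels separate the constructors. *)
Fixpoint ty_code (T : ty) : GenTree.tree nat :=
  match T with
  | Nat => GenTree.Node 0 [::]
  | Bool => GenTree.Node 1 [::]
  | Arr T1 T2 => GenTree.Node 2 [:: ty_code T1; ty_code T2]
  | Prod T1 T2 => GenTree.Node 3 [:: ty_code T1; ty_code T2]
  end.

Fixpoint tm_code (M : tm) : GenTree.tree nat :=
  match M with
  | Var n => GenTree.Leaf n
  | Orc => GenTree.Node 0 [::]
  | Lam T M => GenTree.Node 1 [:: ty_code T; tm_code M]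
  | App M N => GenTree.Node 2 [:: tm_code M; tm_code N]
  | Fix M => GenTree.Node 3 [:: tm_code M]
  | Zero => GenTree.Node 4 [::]
  | Succ M => GenTree.Node 5 [:: tm_code M]
  | Pred M => GenTree.Node 6 [:: tm_code M]
  | IsZero M => GenTree.Node 7 [:: tm_code M]
  | Tru => GenTree.Node 8 [::]
  | Fls => GenTree.Node 9 [::]
  | If L M N => GenTree.Node 10 [:: tm_code L; tm_code M; tm_code N]
  | Pair M N => GenTree.Node 11 [:: tm_code M; tm_code N]
  | Fst M => GenTree.Node 12 [:: tm_code M]
  | Snd M => GenTree.Node 13 [:: tm_code M]
  end.

Lemma ty_code_inj : injective ty_code.
Proof.
by elim=> [||T1 IH1 T2 IH2|T1 IH1 T2 IH2] [||U1 U2|U1 U2] //= [] /IH1-> /IH2->.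
Qed.

Lemma tm_code_inj : injective tm_code.
Proof.
elim=> [n||T M IM|M IM N IN|M IM||M IM|M IM|M IM|||L IL M IM N IN|M IM N IN
  |M IM|M IM] [m||U M'|M' N'|M'||M'|M'|M'|||L' M' N'|M' N'|M'|M'] //= [].
- by move=> ->.
- by move=> /ty_code_inj -> /IM ->.
- by move=> /IM -> /IN ->.
- by move=> /IM ->.
- by move=> /IM ->.
- by move=> /IM ->.
- by move=> /IM ->.
- by move=> /IL -> /IM -> /IN ->.
- by move=> /IM -> /IN ->.
- by move=> /IM ->.
- by move=> /IM ->.
Qed.

(** Implication quantifies over all terms and [normal] over all reducts; countability makes both
    countable intersections. *)
Lemma countable_tm : countable [set: tm].
Proof.
apply/countable_injP; exists (pickle \o tm_code) => M N _ _.
by move=> /(pcan_inj pickleK)/tm_code_inj.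
Qed.

Local Notation omeasurable A := (measurable (A : set cantor)).

(** Serves every condition that does not mention the oracle: equations, typing, bounds on a measure,
    and the value [False] at unsuitable types. *)
Lemma measurable_cst_set (P : Prop) : omeasurable [set _ | P].
Proof.
by have [p|p] := pselect P; [rewrite (_ : mkset _ = setT)|
  rewrite (_ : mkset _ = set0)]; rewrite ?predeqE //; apply/seteqP; split.
Qed.

Lemma countable_bigcapT_measurable (U : Type) (F : U -> set oracle) :
  countable [set: U] -> (forall i, omeasurable (F i)) ->
  omeasurable (\bigcap_i F i).
Proof.
move=> cU mF; rewrite -[X in measurable X]setCK setC_bigcap.
apply: measurableC; apply: countable_bigcupT_measurable => // i.
exact: measurableC.
Qed.

Lemma measurable_and (P Q : oracle -> Prop) :
  omeasurable [set w | P w] -> omeasurable [set w | Q w] ->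
  omeasurable [set w | P w /\ Q w].
Proof. exact: measurableI. Qed.

Lemma measurable_or (P Q : oracle -> Prop) :
  omeasurable [set w | P w] -> omeasurable [set w | Q w] ->
  omeasurable [set w | P w \/ Q w].
Proof. exact: measurableU. Qed.

Lemma measurable_imply (P Q : oracle -> Prop) :
  omeasurable [set w | P w] -> omeasurable [set w | Q w] ->
  omeasurable [set w | P w -> Q w].
Proof.
move=> mP mQ; rewrite (_ : mkset _ = ~` [set w | P w] `|` [set w | Q w]).
  by apply: measurableU => //; exact: measurableC.
apply/seteqP; split=> [w h|w [np|q] //].
by have [p|np] := pselect (P w); [right; exact: h|left].
Qed.

Lemma measurable_forall (U : Type) (P : U -> oracle -> Prop) :
  countable [set: U] -> (forall i, omeasurable [set w | P i w]) ->
  omeasurable [set w | forall i, P i w].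
Proof.
move=> cU mP; rewrite (_ : mkset _ = \bigcap_i [set w | P i w]).
  exact: countable_bigcapT_measurable.
by apply/seteqP; split=> w h i => [_|]; exact: h.
Qed.

Lemma measurable_exists (U : Type) (P : U -> oracle -> Prop) :
  countable [set: U] -> (forall i, omeasurable [set w | P i w]) ->
  omeasurable [set w | exists i, P i w].
Proof.
move=> cU mP; rewrite (_ : mkset _ = \bigcup_i [set w | P i w]).
  exact: countable_bigcupT_measurable.
by apply/seteqP; split=> w [i]; [exists i|move=> _; exists i].
Qed.

Lemma cylinder_measurable s : omeasurable (cylinder s).
Proof. by apply: sub_sigma_algebra; exists s. Qed.

(* Openness in the product topology on oracles. *)
Definition finitary (A : set oracle) :=
  forall w, A w -> exists n, forall w',
    (forall i, (i < n)%N -> w' i = w i) -> A w'.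

Lemma finitary_measurable A : finitary A -> omeasurable A.
Proof.
move=> fA.
(* An open set is the union of the cylinders inside it, and there are only countably many finite
   sequences. *)
have -> : A = \bigcup_(s in [set s | cylinder s `<=` A]) cylinder s.
  apply/seteqP; split=> [w /[dup] Aw /fA[n nA]|w [s sA /sA]//].
  exists (mkseq w n) => [w' h|i]; last first.
    by rewrite size_mkseq => ni; rewrite nth_mkseq.
  apply: nA => i ni; rewrite h ?size_mkseq //.
  exact: nth_mkseq.
rewrite bigcup_mkcond.
apply: countable_bigcupT_measurable => [|s]; first exact: countableP.
by case: ifP => _; [exact: cylinder_measurable|exact: measurable0].
Qed.

Lemma finitary_step M N : finitary [set w | step w M N].
Proof.
move=> w; elim=> {M N} /=.
(* An oracle call is the only rule that reads the oracle, and it reads just position [n], which lies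
   below [n.+1]. *)
3: by move=> n; exists n.+1 => w' /(_ n (ltnSn n)) <-; constructor.
all: try by move=> *; exists 0%N => w' _; constructor.
(* Congruence rules inherit the bound of their premise. *)
all: by move=> > _ [n IH]; exists n => w' /IH; constructor.
Qed.

Lemma finitary_steps M N :
  finitary [set w | clos_refl_trans_1n tm (step w) M N].
Proof.
move=> w; elim=> {M N} [M|M N P /finitary_step[m hm] _ [n hn]].
  by exists 0%N => w' _; exact: rt1n_refl.
exists (maxn m n) => w' ww'; apply: (@Relation_Operators.rt1n_trans _ _ _ N).
  by apply: hm => i im; rewrite ww' // leq_max im.
by apply: hn => i im; rewrite ww' // leq_max im orbT.
Qed.

(** Reduction to [N] is open in the oracle, whereas normality of [N] is a countable intersection of
    closed conditions, one for each potential reduct. *)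
Lemma measurable_converges M N : omeasurable [set w | converges w M N].
Proof.
apply: measurable_and.
  by apply: finitary_measurable; exact: finitary_steps.
apply: measurable_forall => [|N']; first exact: countable_tm.
by apply: measurableC; apply: finitary_measurable; exact: finitary_step.
Qed.

Section formulas.
Variable R : realType.

Lemma measurable_denote e A : omeasurable (denote R e A).
Proof.
elim: A e => /= [t|t s|A IA B IB|A IA B IB|A IA B IB|x A IA|x A IA|t s A IA
  |t s A IA] e; try exact: measurable_cst_set.
(* [FLIP] reads a single position of the oracle, so its denotation is open. *)
- apply: finitary_measurable => w /= wt; exists (aval e t).+1 => w' ww'.
  by rewrite ww'.
- exact: measurableU.
- exact: measurableI.
- by apply: measurableU => //; exact: measurableC.
- exact: bigcup_measurable.
- exact: bigcap_measurableType.
Qed.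

Lemma measurable_realizes e A T M : omeasurable [set w | realizes R e A T M w].
Proof.
elim: A e T M => [t|t s|A IA B IB|A IA B IB|A IA B IB|x A IA|x A IA|t s A IA
  |t s A IA] e T M.
- exact: (measurable_denote e (FLIP t)).
- exact: measurable_cst_set.
- case: T => [||T1 T2|[||? ?|? ?] T2]; try exact: measurable_cst_set.
  by apply: measurable_or; apply: measurable_and => //;
    exact: measurable_converges.
- case: T => [||T1 T2|T1 T2]; try exact: measurable_cst_set.
  exact: measurable_and.
- case: T => [||T1 T2|T1 T2]; try exact: measurable_cst_set.
  apply: measurable_and; first exact: (measurable_denote e (FImp A B)).
  apply: measurable_forall => [|P]; first exact: countable_tm.
  apply: measurable_imply; first exact: measurable_cst_set.
  exact: measurable_imply.
- case: T => [||T1 T2|[||? ?|? ?] T2]; try exact: measurable_cst_set.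
  apply: measurable_exists => [|k]; first exact: countableP.
  by apply: measurable_and => //; exact: measurable_converges.
- case: T => [||[||? ?|? ?] T2|T1 T2]; try exact: measurable_cst_set.
  by apply: measurable_forall => [|k] //; exact: countableP.
(* The measure binds its own oracle [w'], so the clause is constant in [w] and the induction
   hypothesis is not called upon. *)
- case: T => [||[||[||? ?|? ?] [||? ?|? ?]|? ?] T2|T1 T2];
    exact: measurable_cst_set.
- case: T => [||[||[||? ?|? ?] [||? ?|? ?]|? ?] T2|T1 T2];
    rewrite /=; exact: measurable_cst_set.
Qed.

Lemma realizes_denote e A T M w : realizes R e A T M w -> denote R e A w.
Proof.
elim: A e T M w => [t|t s|A IA B IB|A IA B IB|A IA B IB|x A IA|x A IA|t s A IA
  |t s A IA] e T M w //.
- by case: T => // -[]// T2 [] [_]; [move=> /IA; left|move=> /IB; right].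
- by case: T => // T1 T2 [/IA ? /IB].
- by case: T => // T1 T2 [].
- by case: T => // -[]// T2 [k [_ /IA]]; exists k.
- by case: T => // -[]// T2 h k _; exact: IA (h k).
- case: T => // -[]// -[]// -[]// T2 [s0 le]; split=> //.
  (* The induction hypothesis at every oracle [w'] includes the set realizing the body in its
     denotation; monotonicity of the measure then carries the lower bound over. *)
  apply: (Order.POrderTheory.le_trans le); apply: le_measure; rewrite ?inE.
  + exact: measurable_realizes.
  + exact: measurable_denote.
  + by move=> w'; exact: IA.
- by case: T => // -[]// -[]// -[]// T2 [].
Qed.

End formulas.

Theorem theorem5 (R : realType) (T : ty) (M : tm) (w : oracle) (A : form) :
  is_term M T -> closed_form A -> realized R T M w A -> interp R A w.
Proof. by move=> _ _; exact: realizes_denote. Qed.
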